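(* Let $d\ge 1$, let $g_r, g_f \in \mathbb{R}^d$, and let $Q>0$, $R>0$ satisfy $Q \le R\|g_f\|$. Put $\kappa := g_r\cdot g_f$ and $$\kappa_2 := \sqrt{\big(\|g_r\|\,\|g_f\|\big)^2 - \frac{Q^2\|g_r\|^2}{R^2}}.$$ Then there is no $\Delta w\in\mathbb{R}^d$ satisfying simultaneously $$g_r\cdot\Delta w\le 0,\qquad g_f\cdot\Delta w\ge Q,\qquad \|\Delta w\|\le R$$ if and only if $\kappa>\kappa_2$.
   Context: $\cdot$ is the Euclidean inner product and $\|\cdot\|$ the Euclidean norm on $\mathbb{R}^d$. In the application, $g_r$ and $g_f$ are the gradients at the current model weights of the average loss on the retain data and the forget data respectively, and $\Delta w$ is the weight update; infeasibility of the system of three constraints $g_r\cdot\Delta w\le 0$, $g_f\cdot\Delta w\ge Q$, $\|\Delta w\|\le R$ in the unknown $\Delta w\in\mathbb{R}^d$ is what is called unavoidable local collateral forgetting. The statement uses $g_r,g_f$ only as vectors in $\mathbb{R}^d$. *)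

(* Defs.v *)
From mathcomp Require Import all_boot all_order all_algebra.
From mathcomp Require Import reals.
Set Implicit Arguments.
Unset Strict Implicit.
Unset Printing Implicit Defensive.
Import Order.TTheory GRing.Theory Num.Theory.
Local Open Scope ring_scope.

Definition dotr (R : realType) (d : nat) (u v : 'rV[R]_d) : R :=
  \sum_(i < d) u 0 i * v 0 i.

(* Not `|u|: the norm MathComp-Analysis puts on 'rV[R]_d is the sup norm. *)
Definition norm2 (R : realType) (d : nat) (u : 'rV[R]_d) : R :=
  Num.sqrt (dotr u u).

(* Main.v *)
(** Only the projection of [g_f] orthogonally to [g_r] matters. Write
    [a = |g_r|^2], [b = |g_f|^2], [k = g_r . g_f]. If [k <= 0], a multiple of
    [g_f] is feasible. If [k > 0], feasibility amounts to
    [Q <= Rad * |g_f - (k / a) g_r|], the shortest candidate being along this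
    projection, and squaring gives [k^2 <= a b - Q^2 a / Rad^2]. *)

Require Import Defs.
From mathcomp Require Import all_boot all_order all_algebra.
From mathcomp Require Import reals.
From mathcomp Require Import ring lra.
Set Implicit Arguments.
Unset Strict Implicit.
Unset Printing Implicit Defensive.
Import Order.TTheory GRing.Theory Num.Theory.
Local Open Scope ring_scope.

Section EuclideanProduct.
Variables (R : realType) (d : nat).
Implicit Types (u v w : 'rV[R]_d) (c : R).

Lemma dotrC u v : dotr u v = dotr v u.
Proof. by apply: eq_bigr => i _; rewrite mulrC. Qed.

Lemma dotrBl u v w : dotr (u - v) w = dotr u w - dotr v w.
Proof. by rewrite -sumrB; apply: eq_bigr => i _; rewrite !mxE mulrBl. Qed.

Lemma dotrZl c u v : dotr (c *: u) v = c * dotr u v.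
Proof. by rewrite /dotr mulr_sumr; apply: eq_bigr => i _; rewrite mxE mulrA. Qed.

Lemma dotrBr u v w : dotr u (v - w) = dotr u v - dotr u w.
Proof. by rewrite dotrC dotrBl !(dotrC u). Qed.

Lemma dotrZr c u v : dotr u (c *: v) = c * dotr u v.
Proof. by rewrite dotrC dotrZl dotrC. Qed.

Lemma dotr_ge0 u : 0 <= dotr u u.
Proof. by apply: sumr_ge0 => i _; rewrite -expr2 sqr_ge0. Qed.

Lemma dotr_eq0 u v : dotr u u = 0 -> dotr u v = 0.
Proof.
move=> /psumr_eq0P u0; apply: big1 => i _.
have /eqP := u0 (fun j _ => sqr_ge0 (u 0 j)) i isT.
by rewrite -expr2 sqrf_eq0 => /eqP ->; rewrite mul0r.
Qed.

Lemma sqr_norm2 u : norm2 u ^+ 2 = dotr u u.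
Proof. by rewrite sqr_sqrtr ?dotr_ge0. Qed.

Lemma norm2_le u c : 0 <= c -> (norm2 u <= c) = (dotr u u <= c ^+ 2).
Proof. by move=> c0; rewrite -sqr_norm2 ler_sqr ?nnegrE ?sqrtr_ge0. Qed.

(** Cauchy-Schwarz for [w] against [v = a h - k g], which is [a] times the part of [h] orthogonal to
    [g]. As [k >= 0] and [g . w <= 0], passing from [a h] to [v] does not lower the product with
    [w]. *)
Lemma feasible_bound (g h w : 'rV[R]_d) (Q r : R) :
    0 < Q -> 0 < r -> 0 < dotr g g -> 0 <= dotr g h ->
    dotr g w <= 0 -> Q <= dotr h w -> dotr w w <= r ^+ 2 ->
  Q ^+ 2 * dotr g g <= r ^+ 2 * (dotr g g * dotr h h - dotr g h ^+ 2).
Proof.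
move=> Q0 r0 a0 k0 gw hw ww.
set a := dotr g g in a0 *; set k := dotr g h in k0 *; set b := dotr h h.
pose v := a *: h - k *: g.
have vw : a * Q <= dotr v w.
  by rewrite dotrBl !dotrZl; nra.
have vv : dotr v v = a * (a * b - k ^+ 2).
  by rewrite !(dotrBl, dotrBr, dotrZl, dotrZr) (dotrC h g) -/a -/b -/k; ring.
(* With [v] opaque, the bilinear expansion below stops at [v] and [vv] can be used. *)
clearbody v.
(* AM-GM replaces Cauchy-Schwarz for the pair [v], [w]. *)
have := dotr_ge0 (r ^+ 2 *: v - (a * Q) *: w).
rewrite !(dotrBl, dotrBr, dotrZl, dotrZr) (dotrC w v) vv => sq_ge0.
have r20 : 0 < r ^+ 2 by rewrite exprn_gt0.
have aQ0 : 0 < a * Q by rewrite mulr_gt0.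
have vw' : r ^+ 2 * (a * Q) * (a * Q) <= r ^+ 2 * (a * Q) * dotr v w.
  by rewrite ler_pM2l // mulr_gt0.
have ww' : (a * Q) ^+ 2 * dotr w w <= (a * Q) ^+ 2 * r ^+ 2.
  by rewrite ler_pM2l // exprn_gt0.
(* By [vw'] and [ww'], the expanded square is at most [r ^+ 2 * a] times right side minus left
   side. *)
rewrite -(ler_pM2l (mulr_gt0 r20 a0)); lra.
Qed.

(** The witness is the multiple of [a h - k g], orthogonal to [g], with [h . w = Q] exactly; its
    squared norm is [Q ^+ 2 * a / D], which the hypothesis bounds by [r ^+ 2]. *)
Lemma feasible_orth (g h : 'rV[R]_d) (Q r : R) :
    0 < Q -> 0 < r -> 0 < dotr g g ->
    Q ^+ 2 * dotr g g <= r ^+ 2 * (dotr g g * dotr h h - dotr g h ^+ 2) ->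
  exists w, [/\ dotr g w <= 0, Q <= dotr h w & norm2 w <= r].
Proof.
move=> Q0 r0 a0.
set a := dotr g g in a0 *; set k := dotr g h; set b := dotr h h => le_D.
set D := a * b - k ^+ 2 in le_D.
(* The Gram determinant [D] is positive because the left side of [le_D] is. *)
have D0 : 0 < D.
  rewrite -(pmulr_rgt0 _ (exprn_gt0 2 r0)); apply: lt_le_trans le_D.
  by rewrite mulr_gt0 ?exprn_gt0.
have Dn0 : D != 0 by rewrite gt_eqF.
(* The scale is [Q / D] because [h . (a h - k g) = D]. *)
exists ((Q / D) *: (a *: h - k *: g)); split.
- by rewrite dotrZr dotrBr !dotrZr -/a -/k mulrC (mulrC k) subrr mul0r.
- rewrite dotrZr dotrBr !dotrZr (dotrC h g) -/b -/k -expr2 -/D.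
  by rewrite divfK.
- rewrite (norm2_le _ (ltW r0)).
  have -> : dotr ((Q / D) *: (a *: h - k *: g)) ((Q / D) *: (a *: h - k *: g))
           = Q ^+ 2 * a / D.
    transitivity ((Q / D) ^+ 2 * (a * D)); last by field.
    rewrite !(dotrBl, dotrBr, dotrZl, dotrZr) (dotrC h g) -/a -/b -/k /D.
    ring.
  by rewrite ler_pdivrMr.
Qed.

(** The multiple of [h] with [h . w = Q] has norm [Q / |h|], and its product with [g] has the sign
    of [g . h]. *)
Lemma feasible_nonpos (g h : 'rV[R]_d) (Q r : R) :
    0 < Q -> 0 < r -> Q <= r * norm2 h -> dotr g h <= 0 ->
  exists w, [/\ dotr g w <= 0, Q <= dotr h w & norm2 w <= r].
Proof.
move=> Q0 r0 Qle k0.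
have n0 : 0 < norm2 h by rewrite -(pmulr_rgt0 _ r0) (lt_le_trans Q0).
have b0 : 0 < dotr h h by rewrite -sqr_norm2 exprn_gt0.
exists ((Q / dotr h h) *: h); split.
- by rewrite dotrZr pmulr_rle0 // divr_gt0.
- by rewrite dotrZr divfK ?gt_eqF.
- rewrite (norm2_le _ (ltW r0)) dotrZl dotrZr divfK ?gt_eqF //.
  rewrite mulrAC ler_pdivrMr // -expr2 -sqr_norm2 -exprMn.
  by rewrite ler_sqr ?nnegrE // ltW ?mulr_gt0.
Qed.

End EuclideanProduct.

Theorem theorem4p4 (R : realType) (d : nat) (g_r g_f : 'rV[R]_d) (Q Rad : R)
    (d_ge1 : (1 <= d)%N) (Q_gt0 : 0 < Q) (Rad_gt0 : 0 < Rad)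
    (Q_le : Q <= Rad * norm2 g_f) :
  let kappa := dotr g_r g_f in
  let kappa2 := Num.sqrt ((norm2 g_r * norm2 g_f) ^+ 2
                          - Q ^+ 2 * norm2 g_r ^+ 2 / Rad ^+ 2) in
  ~ (exists w : 'rV[R]_d,
       [/\ dotr g_r w <= 0, dotr g_f w >= Q & norm2 w <= Rad])
  <-> kappa > kappa2.
Proof.
move=> kappa kappa2.
have R20 : 0 < Rad ^+ 2 by rewrite exprn_gt0.
(* If [kappa <= 0], both sides of the equivalence fail: the system is feasible, and
   [kappa2 >= 0]. *)
have [k_le0|k_gt0] := leP kappa 0.
  split=> [[]|]; first exact: feasible_nonpos.
  by move=> /(le_lt_trans (sqrtr_ge0 _)); rewrite ltNge k_le0.
have a_gt0 : 0 < dotr g_r g_r.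
  rewrite lt0r dotr_ge0 andbT; apply/eqP => /dotr_eq0 => /(_ g_f) k0.
  by rewrite -/kappa in k0; rewrite k0 ltxx in k_gt0.
have leE : (kappa <= kappa2) = (Q ^+ 2 * dotr g_r g_r <=
    Rad ^+ 2 * (dotr g_r g_r * dotr g_f g_f - kappa ^+ 2)).
  (* [Q_le] makes the radicand nonnegative, so [kappa2] is a genuine root, not the default 0, and
     squaring is reversible. *)
  have S_ge0 : 0 <= (norm2 g_r * norm2 g_f) ^+ 2
                    - Q ^+ 2 * norm2 g_r ^+ 2 / Rad ^+ 2.
    rewrite subr_ge0 ler_pdivrMr // -!exprMn ler_sqr ?nnegrE.
    - by rewrite mulrC -mulrA (mulrC _ Rad) ler_wpM2l ?sqrtr_ge0.
    - by rewrite mulr_ge0 ?sqrtr_ge0 // ltW.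
    - by rewrite !mulr_ge0 ?sqrtr_ge0 // ltW.
  rewrite -ler_sqr ?nnegrE ?sqrtr_ge0 ?(ltW k_gt0) // sqr_sqrtr //.
  rewrite exprMn !sqr_norm2 lerBrDl addrC -lerBrDl.
  by rewrite ler_pdivrMr // (mulrC (Rad ^+ 2)).
split=> [infeasible|lt_k [w [gw hw nw]]].
  rewrite ltNge leE; apply/negP => /(feasible_orth Q_gt0 Rad_gt0 a_gt0).
  exact: infeasible.
move: lt_k; rewrite ltNge leE => /negP; apply.
apply: (feasible_bound Q_gt0 Rad_gt0 a_gt0 (ltW k_gt0) gw hw).
by rewrite -norm2_le // ltW.
Qed.
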